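(* Let $n\geq 4$, let $R$ be a commutative ring, let $x_1,\dots,x_{2n-2}\in R$, and let $J_n=I_2(A_n)$ be the ideal of $R$ generated by the $2$-minors of the $2\times n$ matrix \[ A_n=\begin{pmatrix} 0 & x_1 & x_2 & \cdots & x_{n-2} & x_{n-1}\\ x_n & x_{n+1} & x_{n+2} & \cdots & x_{2n-2} & 0 \end{pmatrix}. \] Then $\mathrm{ara}(J_n)\leq 2n-5$.
   Context: The arithmetical rank $\mathrm{ara}(I)$ of an ideal $I$ of a commutative ring $R$ is the smallest integer $s$ for which there exist $a_1,\dots,a_s\in R$ with $\sqrt{I}=\sqrt{(a_1,\dots,a_s)}$. *)

(* Defs.v *)
From mathcomp Require Import all_boot all_order all_algebra.
From mathcomp Require Import classical_sets.

Set Implicit Arguments.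
Unset Strict Implicit.
Unset Printing Implicit Defensive.

Import GRing.Theory.
Local Open Scope classical_set_scope.
Local Open Scope ring_scope.

(* [comPzRingType] rather than [comNzRingType]: the zero ring is allowed. *)

Definition is_ideal (R : comPzRingType) (I : set R) : Prop :=
  [/\ I 0, forall a b, I a -> I b -> I (a + b) & forall r a, I a -> I (r * a)].

Definition ideal_gen (R : comPzRingType) (S : set R) : set R :=
  smallest (@is_ideal R) S.

Definition radical (R : comPzRingType) (I : set R) : set R :=
  [set a | exists k : nat, I (a ^+ k)].

(* The index functions select rows and columns in strictly increasing order. *)
Definition minors (R : comPzRingType) (t m n : nat) (A : 'M[R]_(m, n)) : set R :=
  [set d | exists (f : 'I_t -> 'I_m) (g : 'I_t -> 'I_n),
    [/\ {homo f : i j / (i < j)%N}, {homo g : i j / (i < j)%N}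
      & d = \det (mxsub f g A)]].

Definition minor_ideal (R : comPzRingType) (t m n : nat) (A : 'M[R]_(m, n)) :
  set R := ideal_gen (minors t A).

Definition generated_up_to_radical (R : comPzRingType) (I : set R) (s : nat) :
  Prop := exists a : 'I_s -> R, radical I = radical (ideal_gen (range a)).

(* Stated as a relation because [ara I] need not be finite in general. *)
Definition is_ara (R : comPzRingType) (I : set R) (s : nat) : Prop :=
  generated_up_to_radical I s /\
  forall t : nat, generated_up_to_radical I t -> (s <= t)%N.

(* Columns are numbered from 0 and the family [x] from 1, so that the entries
   of column [j] are [x j] (0 if [j = 0]) and [x (n + j)] (0 if [j = n - 1]);
   only the values [x 1], ..., [x (2 * n - 2)] occur. *)
Definition A_mx (R : comPzRingType) (n : nat) (x : nat -> R) : 'M[R]_(2, n) :=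
  \matrix_(i < 2, j < n)
    if i == 0%N :> nat then (if j == 0%N :> nat then 0 else x j)
    else (if j == n.-1 :> nat then 0 else x (n + j)%N).

(* Main.v *)
Require Import Defs.
From mathcomp Require Import all_boot all_order all_algebra.
From mathcomp Require Import classical_sets.
From mathcomp Require Import boolp ring zify.

Set Implicit Arguments.
Unset Strict Implicit.
Unset Printing Implicit Defensive.

Import GRing.Theory.
Local Open Scope classical_set_scope.
Local Open Scope ring_scope.

(* Write the matrix as columns (0; y), (a_i; b_i) for 1 <= i <= m = n - 2, and
   (z; 0). Up to radical its 2-minors generate the same ideal as y z together
   with the 2-minors of the matrix B with columns w = (z; y) and (a_i; b_i).
   For a generic 2 x (m + 1) matrix the 2m - 1 antidiagonal sums D_k of minors
   generate the ideal of 2-minors up to radical, so y z costs one generator too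
   many. Put e = [m - 1, m] = D_(2m-1) and replace w by w' = w + e (-1; 1). Then
   D_1, ..., D_(2m-2) of the new matrix together with y z suffice: once all the
   minors other than e vanish, e <> 0 would force w' = 0 by Cramer's rule, and
   then y z = - e ^ 2 <> 0. *)

(** * Ideals, radicals and the existence of a least number of generators *)

Section Radical.
Variable R : comPzRingType.
Implicit Types (I J S : set R) (a b : R).

Lemma ideal_gen_ideal S : is_ideal (ideal_gen S).
Proof.
split=> [J [[]//]|a b Sa Sb J|r a Sa J] [] idJ SJ; case: (idJ) => _ JD JM.
- by apply: JD; [exact: Sa | exact: Sb].
- by apply: JM; exact: Sa.
Qed.

Lemma sub_ideal_gen S : S `<=` ideal_gen S.
Proof. exact: sub_gen_smallest. Qed.

Lemma idealMr I a b : is_ideal I -> I a -> I (a * b).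
Proof. by case=> _ _ IM Ia; rewrite mulrC; exact: IM. Qed.

Lemma idealN I a : is_ideal I -> I a -> I (- a).
Proof. by case=> _ _ IM Ia; rewrite -mulN1r; exact: IM. Qed.

Lemma idealB I a b : is_ideal I -> I a -> I b -> I (a - b).
Proof.
by move=> idI Ia Ib; have [_ ID _] := idI; apply: ID => //; exact: idealN.
Qed.

Lemma ideal_sum I (T : Type) (r : seq T) (P : pred T) (F : T -> R) :
  is_ideal I -> (forall i, P i -> I (F i)) -> I (\sum_(i <- r | P i) F i).
Proof. by case=> I0 ID _ IF; apply: (big_ind I). Qed.

Lemma sub_radical I : I `<=` radical I.
Proof. by move=> a Ia; exists 1%N. Qed.

Lemma radical_ideal I : is_ideal I -> is_ideal (radical I).
Proof.
move=> idI; have [I0 ID IM] := idI; split=> [|a b [k Ik] [l Il]|r a [k Ik]].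
- exact: sub_radical.
- exists (k + l)%N; rewrite exprDn; apply: ideal_sum => // i _.
  rewrite -mulr_natl; apply: (IM).
  have [le_li|lt_il] := leqP l i.
    by rewrite -(subnK le_li) exprD mulrA; exact: IM.
  rewrite -addnBA; last exact: ltnW.
  by rewrite exprD mulrAC; apply: idealMr => //; exact: idealMr.
- by exists k; rewrite exprMn; exact: IM.
Qed.

Lemma radicalX I a k : radical I (a ^+ k) -> radical I a.
Proof. by case=> l; rewrite -exprM => Ia; exists (k * l)%N. Qed.

Lemma radical_ideal_gen_sub S J :
  is_ideal J -> S `<=` radical J -> radical (ideal_gen S) `<=` radical J.
Proof.
move=> idJ SJ a [k Sa]; apply: (@radicalX _ _ k); apply: Sa; split=> //.
exact: radical_ideal.
Qed.

(** Reduces the bound to exhibiting [t] generators; the minimum exists by classical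
    well-ordering. *)
Lemma is_ara_exists I t : generated_up_to_radical I t ->
  exists2 s, is_ara I s & (s <= t)%N.
Proof.
move=> It; have exI : exists s, `[< generated_up_to_radical I s >].
  by exists t; apply/asboolP.
have [s /asboolP Is s_min] := ex_minnP exI.
exists s; last exact/s_min/asboolP.
by split=> // r Ir; exact/s_min/asboolP.
Qed.

End Radical.

(** * Antidiagonal sums of 2-minors *)

Section Antidiagonals.
Variables (R : comPzRingType) (c d : nat -> R).

Definition col_minor (i j : nat) : R := c i * d j - c j * d i.

(** The sums [D_k] for columns 0, ..., [m]; a minor occurs only for 1 <= k <= 2m - 1. *)
Definition antidiag_sum (m k : nat) : R :=
  \sum_(i < k | (i < k - i <= m)%N) col_minor i (k - i).

(** Oriented so that, for i < i' < j' < j with i + j = i' + j', the first factor of each product on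
    the right has a smaller index sum. *)
Lemma col_minor_pluecker i i' j' j :
  col_minor i j * col_minor i' j' =
  col_minor i j' * col_minor i' j - col_minor i i' * col_minor j' j.
Proof. rewrite /col_minor; ring. Qed.

(* Modulo the minors of smaller index sum, the Plücker relations make the
   products of distinct minors on one antidiagonal vanish. *)
Lemma radical_antidiag_sum (I : set R) (m K : nat) : is_ideal I ->
  (forall k, (0 < k <= K)%N -> radical I (antidiag_sum m k)) ->
  forall i j, (i < j <= m)%N -> (i + j <= K)%N -> radical I (col_minor i j).
Proof.
move=> /radical_ideal idP PD i j; move Dk: (i + j)%N => k.
have [_ PD2 PM] := idP.
elim/ltn_ind: k i j Dk => k IHk i j Dk ijm kK.
have lt_ik : (i < k)%N by lia.
have Dj : j = (k - i)%N by lia.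
pose i0 := Ordinal lt_ik.
apply: (@radicalX _ _ _ 2).
have -> : col_minor i j ^+ 2 = col_minor i j * antidiag_sum m k -
    \sum_(l < k | (l < k - l <= m)%N && (l != i0))
       col_minor i j * col_minor l (k - l).
  rewrite /antidiag_sum (bigD1 i0) /=; last by rewrite -Dj.
  by rewrite mulrDr mulr_sumr addrK -Dj.
apply: idealB => //; first by apply: PM; apply: PD; lia.
apply: ideal_sum => // l /andP[lm /eqP/val_eqP/= /eqP ne_li].
have [lt_il|le_li] := ltnP i l.
  rewrite col_minor_pluecker; apply: idealB => //; apply: idealMr => //.
    by apply: (IHk (i + (k - l))%N) => //; lia.
  by apply: (IHk (i + l)%N) => //; lia.
(* Now [l < i], so the pair of [l] is the outer one and the factors are swapped first. *)
rewrite mulrC col_minor_pluecker; apply: idealB => //; apply: idealMr => //.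
  by apply: (IHk (l + j)%N) => //; lia.
by apply: (IHk (l + i)%N) => //; lia.
Qed.

End Antidiagonals.

(** * The 2-minors of [A_mx] *)

Lemma det_mx22 (R : comPzRingType) (B : 'M[R]_2) :
  \det B = B ord0 ord0 * B ord_max ord_max - B ord0 ord_max * B ord_max ord0.
Proof.
rewrite (expand_det_row B ord0) !big_ord_recl big_ord0 /cofactor !det_mx11.
rewrite !mxE /=.
have -> : lift ord0 ord0 = ord_max :> 'I_2 by apply: val_inj.
have -> : lift ord_max 0 = ord0 :> 'I_2 by apply: val_inj.
rewrite expr0 expr1; ring.
Qed.

Lemma minors2P (R : comPzRingType) (n : nat) (A : 'M[R]_(2, n)) (u : R) :
  minors 2 A u <-> exists i j : 'I_n, (i < j)%N /\
    u = A ord0 i * A ord_max j - A ord0 j * A ord_max i.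
Proof.
split=> [[f [g [f_incr g_incr ->]]]|[i [j [lt_ij ->]]]].
  exists (g ord0), (g ord_max); split; first exact: g_incr.
  (* A strictly increasing self-map of ['I_2] is the identity. *)
  have lt_f : (f ord0 < f ord_max)%N by apply: f_incr.
  have lt_f1 := ltn_ord (f ord_max).
  have f0 : f ord0 = ord0 by apply: val_inj => /=; lia.
  have f1 : f ord_max = ord_max by apply: val_inj => /=; lia.
  by rewrite det_mx22 !mxE f0 f1.
exists id, (fun k => if k == ord0 then i else j); split.
- by [].
- by move=> [[|[|k]] k2] [[|[|l]] l2].
- by rewrite det_mx22 !mxE.
Qed.

(** Sorts the column pairs by whether they involve the first or the last column, dropping signs. The
    ideal is arbitrary so that both inclusions of the theorem can use it. *)
Lemma minors_A_mx_sub (R : comPzRingType) (n : nat) (x : nat -> R)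
    (I : set R) : (2 <= n)%N -> is_ideal I ->
  minors 2 (A_mx n x) `<=` I <->
  [/\ I (x n.-1 * x n),
      forall j, (0 < j < n.-1)%N -> I (x n * x j) /\ I (x n.-1 * x (n + j)%N)
    & forall i j, (0 < i < j)%N -> (j < n.-1)%N ->
        I (col_minor x (fun k => x (n + k)%N) i j)].
Proof.
move=> n2 idI; split=> [sub_I|[Iyz Iyz_col Iinner] u].
  have minorI i j : (i < j < n)%N -> I
      ((if i == 0 then 0 else x i) * (if j == n.-1 then 0 else x (n + j)%N) -
       (if j == 0 then 0 else x j) * (if i == n.-1 then 0 else x (n + i)%N)).
    case/andP=> lt_ij lt_jn; apply/sub_I/minors2P.
    exists (Ordinal (ltn_trans lt_ij lt_jn)), (Ordinal lt_jn); split=> //.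
    by rewrite !mxE.
  split=> [|j j_in|i j i_in lt_jn].
  - have := minorI 0 n.-1; rewrite !eqxx /= !ifF; try lia.
    rewrite addn0 mulr0 sub0r => /(_ ltac:(lia)) /(idealN idI).
    by rewrite opprK.
  - split.
      have := minorI 0 j; rewrite !eqxx /= !ifF; try lia.
      rewrite addn0 mul0r sub0r => /(_ ltac:(lia)) /(idealN idI).
      by rewrite opprK mulrC.
    have := minorI j n.-1; rewrite !eqxx /= !ifF; try lia.
    rewrite mulr0 sub0r => /(_ ltac:(lia)) /(idealN idI).
    by rewrite opprK.
  - have := minorI i j; rewrite !ifF; try lia.
    by apply; lia.
case/minors2P=> i [j [lt_ij ->]]; rewrite !mxE /=.
have lt_jn := ltn_ord j; have -> : (j == 0 :> nat)%N = false by lia.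
have -> : (i == n.-1 :> nat)%N = false by lia.
case: (posnP i) => [->|i_gt0]; case: (eqVneq (j : nat) n.-1) => [->|j_neq].
- by rewrite addn0 mul0r sub0r; apply: idealN.
- rewrite addn0 mul0r sub0r mulrC; apply: idealN => //.
  by case: (Iyz_col j) => //; lia.
- rewrite mulr0 sub0r; apply: idealN => //.
  by case: (Iyz_col i) => //; lia.
- by apply: Iinner; lia.
Qed.

(** * The 2n - 5 generators and the two inclusions *)

Theorem theorem5p4 (n : nat) (hn : (4 <= n)%N) (R : comPzRingType)
    (x : nat -> R) :
  exists2 s : nat,
    is_ara (minor_ideal 2 (A_mx n x)) s & (s <= 2 * n - 5)%N.
Proof.
set J := minor_ideal 2 _; apply: is_ara_exists.
pose y := x n; pose z := x n.-1; pose m := (n - 2)%N.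
pose a := x; pose b k := x (n + k)%N.
pose e := col_minor a b m.-1 m.
pose c k := if k == 0 then z - e else a k.
pose d k := if k == 0 then y + e else b k.
(* Antidiagonal 0 is empty, so its slot holds [z * y]; the others run up to 2n - 6 = 2m - 2. *)
pose g (k : 'I_(2 * n - 5)) :=
  if k == 0 :> nat then z * y else antidiag_sum c d m k.
have idJ : is_ideal J by exact: ideal_gen_ideal.
have idG : is_ideal (ideal_gen (range g)) by exact: ideal_gen_ideal.
have idP := radical_ideal idG.
exists g; apply/seteqP; split; apply: radical_ideal_gen_sub => //.
  have [_ PD PM] := idP.
  have Pg k : (k < 2 * n - 5)%N -> radical (ideal_gen (range g))
      (if k == 0 then z * y else antidiag_sum c d m k).
    move=> lt_k; apply: sub_radical; apply: sub_ideal_gen.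
    by exists (Ordinal lt_k).
  have Pyz : radical (ideal_gen (range g)) (z * y) by apply: (Pg 0); lia.
  have Pcd i j : (i < j <= m)%N -> (i + j <= 2 * n - 6)%N ->
      radical (ideal_gen (range g)) (col_minor c d i j).
    apply: radical_antidiag_sum => // k k_in.
    by have := Pg k; rewrite ifF; [apply; lia | lia].
  (* Here n >= 4 enters: it gives j <= m = n - 2 <= 2n - 6. *)
  have Pcd0 j : (0 < j <= m)%N -> radical (ideal_gen (range g))
      ((z - e) * b j - a j * (y + e)).
    move=> j_in; have := Pcd 0 j; rewrite /col_minor /c /d /= !ifF; try lia.
    by apply; lia.
  (* Cramer's rule puts the multiples [(z - e) * e] and [(y + e) * e] in the
     radical, which modulo [e * (z * y)] leaves [e ^+ 3]. *)
  have Pe : radical (ideal_gen (range g)) e.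
    have Pm := Pcd0 m ltac:(lia); have Pm1 := Pcd0 m.-1 ltac:(lia).
    have Pze : radical (ideal_gen (range g)) ((z - e) * e).
      have -> : (z - e) * e = a m.-1 * ((z - e) * b m - a m * (y + e))
          - a m * ((z - e) * b m.-1 - a m.-1 * (y + e)).
        rewrite -[LHS]/((z - e) * col_minor a b m.-1 m) /col_minor; ring.
      by apply: idealB => //; apply: PM.
    have Pye : radical (ideal_gen (range g)) ((y + e) * e).
      have -> : (y + e) * e = b m.-1 * ((z - e) * b m - a m * (y + e))
          - b m * ((z - e) * b m.-1 - a m.-1 * (y + e)).
        rewrite -[LHS]/((y + e) * col_minor a b m.-1 m) /col_minor; ring.
      by apply: idealB => //; apply: PM.
    apply: (@radicalX _ _ _ 3).
    have -> : e ^+ 3 = y * ((z - e) * e) + e * ((y + e) * e) - e * (z * y).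
      by ring.
    by apply: idealB => //; [apply: (PD); apply: (PM) | apply: (PM)].
  (* With [e] in the radical, the modified column can be traded back for (z; y). *)
  have Pzy j : (0 < j <= m)%N ->
      radical (ideal_gen (range g)) (z * b j - y * a j).
    move=> j_in; have -> : z * b j - y * a j =
      ((z - e) * b j - a j * (y + e)) + (a j + b j) * e by ring.
    by apply: PD; [exact: Pcd0 | exact: PM].
  apply/minors_A_mx_sub => //; first lia.
  split=> // [j j_in|i j i_in lt_jn].
    have Pj := Pzy j ltac:(lia).
    (* [y * a j] and [z * b j] have their difference and their product in the radical, hence also
       their squares. *)
    split; apply: (@radicalX _ _ _ 2).
      rewrite -/y -/(a j).
      have -> : (y * a j) ^+ 2 = a j * b j * (z * y)
          - y * a j * (z * b j - y * a j) by ring.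
      by apply: idealB => //; apply: PM.
    rewrite -/z -/(b j).
    have -> : (z * b j) ^+ 2 = z * b j * (z * b j - y * a j)
        + a j * b j * (z * y) by ring.
    by apply: PD; apply: PM.
  rewrite -/a -/b.
  (* The only pair i < j <= m with i + j >= 2m - 1 is (m - 1, m), whose minor is [e]. *)
  have [lt_ij|ge_ij] := ltnP (i + j) (2 * n - 5).
    have := Pcd i j; rewrite /col_minor /c /d !ifF; try lia.
    by apply; lia.
  have [-> ->] : i = m.-1 /\ j = m by lia.
  exact: Pe.
(* Converse inclusion: the generators lie in [J] itself, since [e] does and the change of column 0
   alters its minors by multiples of [e]. *)
have [_ _ JM] := idJ.
have [Jzy Jzy_col Jinner] : [/\ J (x n.-1 * x n),
    forall j, (0 < j < n.-1)%N -> J (x n * x j) /\ J (x n.-1 * x (n + j)%N)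
    & forall i j, (0 < i < j)%N -> (j < n.-1)%N ->
        J (col_minor x (fun k => x (n + k)%N) i j)].
  by apply/minors_A_mx_sub; [lia | exact: idJ | exact: sub_ideal_gen].
have Je : J e by apply: Jinner; lia.
move=> _ [k _ <-]; apply: sub_radical; rewrite /g.
case: eqP => // _; apply: ideal_sum => // l l_in.
rewrite /col_minor /c /d; have -> : (k - l == 0)%N = false by lia.
case: (posnP l) => [l0|l_gt0] /=; last first.
  by apply: Jinner; lia.
move: l_in; rewrite l0 subn0; set j := (k : nat) => j_in.
have [Jya Jzb] := Jzy_col j ltac:(lia).
have -> : (z - e) * b j - a j * (y + e) =
  z * b j - y * a j - (a j + b j) * e by ring.
by apply: (idealB idJ); [exact: (idealB idJ) | exact: (JM _ _ Je)].
Qed.
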